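(* There is no set $\{a,b,c\}\subset \mathbb{R}[X]$ of (three) distinct nonzero polynomials such that all of the following hold: (1) at least one of $a,b,c$ is nonconstant; (2) none of $a,b,c$ is equal to $1$; (3) all seven polynomials $$a+1,\quad b+1,\quad c+1,\quad ab+1,\quad ac+1,\quad bc+1,\quad abc+1$$ are perfect squares in $\mathbb{R}[X]$.
   Context: A polynomial is a perfect square in $\mathbb{R}[X]$ if it equals $g^2$ for some $g\in\mathbb{R}[X]$. *)

(* Defs.v *)
(* MathComp world; the real numbers are an arbitrary [R : realType]. *)
From HB Require Import structures.
From mathcomp Require Import all_boot all_order all_algebra.
From mathcomp Require Import reals.

Set Implicit Arguments.
Unset Strict Implicit.
Unset Printing Implicit Defensive.

Import Order.TTheory GRing.Theory Num.Theory.
Local Open Scope ring_scope.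

Definition perfect_square (R : realType) (p : {poly R}) : Prop :=
  exists g : {poly R}, p = g ^+ 2.

(* [size p] is the degree plus one, with [size 0 = 0]. *)
Definition nonconstant (R : realType) (p : {poly R}) : Prop :=
  (1 < size p)%N.

(* Main.v *)
(* Comparing leading coefficients shows that all three polynomials are
   nonconstant and eventually positive: for constant k, the polynomials p + 1
   and k p + 1 are both squares of a nonconstant p only if k is 0 or 1.  Let
   deg a <= deg b <= deg c.  If deg b = deg c, the small regular extension of
   {a, b, c} has negative degree, hence is 0; comparing degrees and leading
   coefficients with those in the triples {1, x, y} gives a contradiction.
   Otherwise
   deg c >= deg a + deg b, and since ab = 1 * ab, the triples {a, b, c} and
   {1, ab, c} share the square root r of ab + 1; let d and d' be their small
   regular extensions, so that
     c + d - a - b = 2 r w,    c d + 1 = w ^ 2,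
     c + d' - 1 - ab = 2 r w', c d' + 1 = w' ^ 2.
   If deg c = deg a + deg b, then d is constant, so d = 1 and c has 4 times the
   leading coefficient of ab, which is impossible for {1, ab, c}.  If
   deg c > deg a + deg b, eliminating r, w and w' forces d - d' = 1/2, and what
   then remains of the eliminant has positive leading coefficient. *)
Require Import Defs.
From HB Require Import structures.
From mathcomp Require Import all_boot all_order all_algebra.
From mathcomp Require Import reals.
From mathcomp Require Import zify ring lra.

Set Implicit Arguments.
Unset Strict Implicit.
Unset Printing Implicit Defensive.

Import Order.TTheory GRing.Theory Num.Theory.
Local Open Scope ring_scope.

(* [lia] distinguishes the sizes whose ring structure was inferred along
   different paths; [psize] fixes one path. *)
Definition psize (R : realType) (p : {poly R}) : nat := size p.

(* Polynomial hypotheses are cleared because their preprocessing by [lia] is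
   very slow. *)
Ltac size_lia :=
  intros;
  repeat match goal with
  | H : ?T |- _ =>
      lazymatch T with
      | is_true (leq _ _) => fail
      | @eq nat _ _ => fail
      | @eq (Equality.sort _) _ _ => fail
      | not (@eq _ _ _) => fail
      | nat => fail
      | _ => clear H
      end
  end;
  repeat match goal with
  | H : context [@size ?A (@polyseq ?S ?p)] |- _ =>
      change (@size A (@polyseq S p)) with (psize p) in H
  | |- context [@size ?A (@polyseq ?S ?p)] =>
      change (@size A (@polyseq S p)) with (psize p)
  end;
  lia.

(** * Sizes, leading coefficients and top coefficients *)

Lemma lead_coefD_gt0 (R : realFieldType) (p q : {poly R}) :
  0 < lead_coef p -> 0 < lead_coef q ->
  0 < lead_coef (p + q) /\ size (p + q) = maxn (size p) (size q).
Proof.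
move=> p0 q0; case: (ltngtP (size p) (size q)) => h.
- by rewrite addrC lead_coefDl // size_polyDl.
- by rewrite lead_coefDl // size_polyDl.
have hc : (p + q)`_(size p).-1 = lead_coef p + lead_coef q.
  by rewrite coefD /lead_coef -h.
have hs : size (p + q) = size p.
  apply/eqP; rewrite eqn_leq; apply/andP; split.
    by rewrite (leq_trans (size_polyD _ _)) // h maxnn.
  rewrite leqNgt; apply/negP => hlt.
  have : (p + q)`_(size p).-1 = 0 by rewrite nth_default // -ltnS (ltn_predK hlt).
  by rewrite hc => e; lra.
split; last by rewrite hs.
by rewrite {1}/lead_coef hs hc; lra.
Qed.

Lemma lead_coefM_gt0 (R : realFieldType) (p q : {poly R}) :
  0 < lead_coef p -> 0 < lead_coef q -> 0 < lead_coef (p * q).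
Proof. by move=> p0 q0; rewrite lead_coefM mulr_gt0. Qed.

Lemma lead_coef_nat_gt0 (R : realFieldType) n :
  0 < lead_coef (n.+1%:R : {poly R}).
Proof. by rewrite -polyC_natr lead_coefC ltr0n. Qed.

Lemma lead_coef_gt0_neq0 (R : realFieldType) (p : {poly R}) :
  0 < lead_coef p -> p != 0.
Proof. by move=> p0; rewrite -lead_coef_eq0 gt_eqF. Qed.

Lemma size_natM (R : realFieldType) n (p : {poly R}) :
  size (n.+1%:R * p) = size p.
Proof. by rewrite -polyC_natr mul_polyC size_scale // pnatr_eq0. Qed.

Lemma size_polyD_leq (R : nzRingType) (p q : {poly R}) k :
  (size p <= k)%N -> (size q <= k)%N -> (size (p + q)%R <= k)%N.
Proof.
by move=> hp hq; apply: leq_trans (size_polyD _ _) _; rewrite geq_max hp hq.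
Qed.

Lemma size_polyB_leq (R : nzRingType) (p q : {poly R}) k :
  (size p <= k)%N -> (size q <= k)%N -> (size (p - q)%R <= k)%N.
Proof. by move=> hp hq; apply: size_polyD_leq; rewrite ?size_polyN. Qed.

Lemma size_polyM_leq (R : nzRingType) (p q : {poly R}) m n k :
  (size p <= m.+1)%N -> (size q <= n.+1)%N -> (m + n < k)%N ->
  (size (p * q)%R <= k)%N.
Proof.
move=> hp hq; apply: leq_trans; apply: leq_trans (size_polyMleq _ _) _.
rewrite -subn1; apply: leq_trans (leq_sub2r 1 (leq_add hp hq)) _.
by rewrite addSn addnS subn1.
Qed.

Lemma size_nat_leq (R : realFieldType) n k :
  (size (n%:R : {poly R})%R <= k.+1)%N.
Proof. by rewrite -polyC_natr; apply: leq_trans (size_polyC_leq1 _) _. Qed.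

Lemma size_sqr (R : idomainType) (p : {poly R}) :
  size (p ^+ 2) = (size p + size p).-1.
Proof.
have [->|p0] := eqVneq p 0; first by rewrite expr2 mulr0 size_poly0.
by rewrite expr2 size_mul.
Qed.

Lemma size_polyD1 (R : nzRingType) (p : {poly R}) :
  (1 < size p)%N -> size (p + 1) = size p.
Proof. by move=> p1; rewrite size_polyDl // size_poly1. Qed.

(** [m] and [n] only bound the degrees, so the formula still applies to differences whose top
    coefficient may vanish. *)
Lemma coefM_top (R : nzRingType) (p q : {poly R}) m n :
  (size p <= m.+1)%N -> (size q <= n.+1)%N -> (p * q)`_(m + n) = p`_m * q`_n.
Proof.
move=> hp hq; have hm : (m < (m + n).+1)%N by lia.
rewrite coefM (bigD1 (Ordinal hm)) //= addKn big1 ?addr0 // => i ni.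
have {}ni : (i : nat) <> m by move=> e; move/eqP: ni; apply; apply/val_inj.
have [hi|hi] := ltnP m i.
  by rewrite nth_default ?mul0r // (leq_trans hp).
by rewrite [q`__]nth_default ?mulr0 // (leq_trans hq) //; lia.
Qed.

(** * Square conditions for a polynomial and its constant multiples *)

Lemma perfect_square_lead_coef (R : realType) (p : {poly R}) :
  perfect_square p -> p != 0 -> exists2 g, p = g ^+ 2 & 0 < lead_coef g.
Proof.
move=> [g ->] n0; have g0 : g != 0 by move: n0; rewrite expf_eq0.
have [h|h|h] := ltgtP 0 (lead_coef g); first by exists g.
  by exists (- g); rewrite ?sqrrN // lead_coefN; lra.
by move/eqP: h; rewrite eq_sym lead_coef_eq0 (negbTE g0).
Qed.

Lemma perfect_square_lead_gt0 (R : realType) (p : {poly R}) :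
  nonconstant p -> perfect_square (p + 1) -> 0 < lead_coef p.
Proof.
move=> np [g e]; have l : lead_coef (p + 1) = lead_coef p.
  by rewrite lead_coefDl // size_poly1.
have p0 : p != 0 by rewrite -size_poly_gt0; apply: ltn_trans np.
rewrite lt0r lead_coef_eq0 p0 -l e lead_coef_exp /=.
exact: sqr_ge0.
Qed.

(** If [p + 1 = u ^+ 2] and [k p + 1 = v ^+ 2], leading coefficients give [k > 0] for nonzero [k],
    and [k u^2 - v^2 = k - 1] factors over the reals. For [k] different from 1 both factors are
    nonzero constants, hence so is their sum, a multiple of [u]. *)
Lemma perfect_square_scale (R : realType) (k : R) (p : {poly R}) :
  nonconstant p -> perfect_square (p + 1) -> perfect_square (k%:P * p + 1) ->
  k = 0 \/ k = 1.
Proof.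
move=> np sp; have lp := perfect_square_lead_gt0 np sp.
case: sp => u eu sv.
have [k0|k0] := eqVneq k 0; [by left | right].
have nk : nonconstant (k%:P * p) by rewrite /nonconstant mul_polyC size_scale.
have := perfect_square_lead_gt0 nk sv.
rewrite lead_coefM lead_coefC pmulr_lgt0 // => kp.
case: sv => v ev; apply/eqP/negPn/negP => k1.
pose f := (Num.sqrt k)%:P * u - v; pose g := (Num.sqrt k)%:P * u + v.
have fg : f * g = (k - 1)%:P.
  have -> : f * g = ((Num.sqrt k)%:P ^+ 2) * u ^+ 2 - v ^+ 2.
    by rewrite /f /g; ring.
  rewrite -rmorphXn /= sqr_sqrtr ?ltW // -eu -ev rmorphB /=.
  by ring.
have n1 : (k - 1)%:P != 0 :> {poly R} by rewrite polyC_eq0 subr_eq0.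
have fg0 : f * g != 0 by rewrite fg.
move: (fg0); rewrite mulf_eq0 negb_or => /andP[f0 g0].
have := size_mul f0 g0; rewrite fg size_polyC subr_eq0 k1 /= => hs.
have sf0 := f0; have sg0 := g0; rewrite -!size_poly_gt0 in sf0 sg0.
have su : (size u <= 1)%N.
  have -> : size u = size (f + g).
    have -> : f + g = (2 * Num.sqrt k)%:P * u by rewrite /f /g polyCM; ring.
    by rewrite mul_polyC size_scale // mulf_neq0 // gt_eqF ?sqrtr_gt0.
  by apply: leq_trans (size_polyD _ _) _; rewrite geq_max; apply/andP; split; size_lia.
have : size (p + 1) = size p by rewrite size_polyDl // size_poly1.
rewrite eu expr2 => s2.
have := size_polyMleq u u; rewrite s2; move: np; rewrite /nonconstant; size_lia.
Qed.

(** * Small regular extensions of a triple *)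

(** The right side has degree at most [2 deg z], while the conjugate [D] takes up at least
    [deg x + deg y + deg z]. The [+ 2] converts degrees to sizes. *)
Lemma regular_conjugate_size (R : realType) (x y z d D : {poly R}) :
  x != 0 -> y != 0 -> z != 0 -> d != 0 ->
  (size x <= size z)%N -> (size y <= size z)%N ->
  (size (x * y * z)%R <= size D)%N ->
  d * D = x * x + y * y + z * z - 2 * (x * y) - 2 * (x * z) - 2 * (y * z) - 4 ->
  (size d + size x + size y <= size z + 2)%N.
Proof.
move=> xn yn zn d0 xz yz sD dD.
have := size_mul (mulf_neq0 xn yn) zn; rewrite (size_mul xn yn) => sxyz.
have x0 : (0 < size x)%N by rewrite size_poly_gt0.
have y0 : (0 < size y)%N by rewrite size_poly_gt0.
have z0 : (0 < size z)%N by rewrite size_poly_gt0.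
have Dn : D != 0.
  rewrite -size_poly_gt0; apply: leq_trans sD.
  by rewrite size_poly_gt0 !mulf_neq0.
have D0 : (0 < size D)%N by rewrite size_poly_gt0.
have sdD := size_mul d0 Dn.
have bd (u v : {poly R}) : (size u <= size z)%N -> (size v <= size z)%N ->
    (size (u * v)%R <= (size z + size z).-1)%N.
  move=> hu hv; apply: leq_trans (size_polyMleq _ _) _.
  by rewrite -!subn1 leq_sub2r // leq_add.
have : (size (d * D)%R <= (size z + size z).-1)%N.
  have b4 : (size (4 : {poly R})%R <= (size z + size z).-1)%N.
    by rewrite -(ltn_predK z0) addSn addnS; apply: size_nat_leq.
  have bd2 (u v : {poly R}) : (size u <= size z)%N -> (size v <= size z)%N ->
      (size (2 * (u * v))%R <= (size z + size z).-1)%N.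
    by rewrite size_natM; apply: bd.
  rewrite dD; apply: size_polyB_leq b4; apply: size_polyB_leq (bd2 _ _ _ _) => //.
  apply: size_polyB_leq (bd2 _ _ _ _) => //; apply: size_polyB_leq (bd2 _ _ _ _) => //.
  by apply: size_polyD_leq (bd _ _ _ _) => //; apply: size_polyD_leq; apply: bd.
rewrite sdD; rewrite sxyz in sD; clear -x0 y0 z0 D0 sD; size_lia.
Qed.

(* [d] is the smaller of the two regular extensions
   [x + y + z + 2xyz -+ 2rst] of the triple; the product of the two is
   [x^2 + y^2 + z^2 - 2xy - 2xz - 2yz - 4], which bounds the degree of [d]. *)
Lemma regular_extension (R : realType) (x y z r : {poly R}) :
  0 < lead_coef x -> 0 < lead_coef y -> 0 < lead_coef z -> 0 < lead_coef r ->
  (size x <= size z)%N -> (size y <= size z)%N -> x * y + 1 = r ^+ 2 ->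
  perfect_square (x * z + 1) -> perfect_square (y * z + 1) ->
  exists d w : {poly R}, [/\ z * d + 1 = w ^+ 2, z + d - x - y = 2 * r * w &
    d != 0 -> (size d + size x + size y <= size z + 2)%N].
Proof.
move=> x0 y0 z0 r0 xz yz er ss st.
have one0 := lead_coef_nat_gt0 R 0.
have nz (u v : {poly R}) : 0 < lead_coef u -> 0 < lead_coef v -> u * v + 1 != 0.
  move=> u0 v0; apply: lead_coef_gt0_neq0.
  by case: (lead_coefD_gt0 (lead_coefM_gt0 u0 v0) one0).
have [s es s0] := perfect_square_lead_coef ss (nz _ _ x0 z0).
have [t et t0] := perfect_square_lead_coef st (nz _ _ y0 z0).
exists (x + y + z + 2 * (x * y * z) - 2 * (r * s * t)), (z * r - s * t); split.
- have -> : (z * r - s * t) ^+ 2 =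
      z ^+ 2 * r ^+ 2 + s ^+ 2 * t ^+ 2 - 2 * z * r * s * t by ring.
  by rewrite -er -es -et; ring.
- have -> : 2 * r * (z * r - s * t) = 2 * r ^+ 2 * z - 2 * r * s * t by ring.
  by rewrite -er; ring.
move=> d0.
have xyz0 := lead_coefM_gt0 (lead_coefM_gt0 x0 y0) z0.
have [xyz20 s2] := lead_coefD_gt0 xyz0 xyz0.
have [A0 _] := lead_coefD_gt0 x0 y0.
have [B0 _] := lead_coefD_gt0 A0 z0.
have rst0 := lead_coefM_gt0 (lead_coefM_gt0 r0 s0) t0.
have [C0 _] := lead_coefD_gt0 B0 (lead_coefM_gt0 (lead_coef_nat_gt0 R 1) rst0).
have [D0 sD] := lead_coefD_gt0 xyz20 C0.
(* [D] is the conjugate extension, grouped into terms with positive leading coefficients: nothing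
   cancels, so its size is at least that of [x * y * z]. *)
apply: (regular_conjugate_size _ _ _ d0 xz yz
  (D := x * y * z + x * y * z + (x + y + z + 2 * (r * s * t)))).
- exact: lead_coef_gt0_neq0.
- exact: lead_coef_gt0_neq0.
- exact: lead_coef_gt0_neq0.
- by rewrite sD s2 maxnn leq_maxl.
have -> : (x + y + z + 2 * (x * y * z) - 2 * (r * s * t)) *
    (x * y * z + x * y * z + (x + y + z + 2 * (r * s * t))) =
    (x + y + z + 2 * (x * y * z)) ^+ 2 - 4 * (r ^+ 2 * s ^+ 2 * t ^+ 2) by ring.
by rewrite -er -es -et; ring.
Qed.

(* The regular extension [d] of a triple [{1, x, y}] with [x] and [y] of the
   same degree is constant, hence 0 or 1. *)
Lemma equal_degree_pair (R : realType) (x y : {poly R}) :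
  nonconstant x -> size x = size y ->
  perfect_square (x + 1) -> perfect_square (y + 1) ->
  perfect_square (x * y + 1) ->
  (y - x - 1) ^+ 2 = 4 * (x + 1) \/ (y - x) ^+ 2 = 4 * ((x + 1) * (y + 1)).
Proof.
move=> nx sxy sx sy sp; have ny : nonconstant y by rewrite /nonconstant -sxy.
have x0 := perfect_square_lead_gt0 nx sx.
have y0 := perfect_square_lead_gt0 ny sy.
have one0 := lead_coef_nat_gt0 R 0.
have [xp _] := lead_coefD_gt0 x0 one0.
have [r er r0] := perfect_square_lead_coef sx (lead_coef_gt0_neq0 xp).
have sx1 : (size (1 : {poly R})%R <= size y)%N.
  by rewrite size_poly1; apply: ltnW.
have e1 : 1 * x + 1 = r ^+ 2 by rewrite mul1r.
have s1 : perfect_square (1 * y + 1) by rewrite mul1r.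
have sl : (size x <= size y)%N by rewrite sxy.
have [d [w [ew eq sd]]] := regular_extension one0 x0 y0 r0 sx1 sl e1 s1 sp.
have cd : (size d <= 1)%N.
  have [->|/sd] := eqVneq d 0; first by rewrite size_poly0.
  by rewrite size_poly1 sxy; size_lia.
have sqe : (y + d - 1 - x) ^+ 2 = 4 * ((x + 1) * (y * d + 1)).
  by rewrite eq ew er; ring.
rewrite (size1_polyC cd) in ew sqe.
have [k|k] : d`_0 = 0 \/ d`_0 = 1.
  by apply: (perfect_square_scale ny sy); exists w; rewrite mulrC.
- left; move: sqe; rewrite k mulr0 add0r mulr1 addr0 => <-; ring.
- right; move: sqe; rewrite k mulr1 => <-; ring.
Qed.

(** * Leading coefficients and the case of two largest degrees equal *)

(** Compares coefficients in degree [2 (m + 1)]; in the first alternative [4 (x + 1)] has smaller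
    degree, so the top terms of [y - x] cancel. *)
Lemma equal_degree_pair_coef (R : realType) (x y : {poly R}) m :
  size x = m.+2 -> size y = m.+2 ->
  perfect_square (x + 1) -> perfect_square (y + 1) ->
  perfect_square (x * y + 1) ->
  y`_m.+1 = x`_m.+1 \/ (y`_m.+1 - x`_m.+1) ^+ 2 = 4 * (x`_m.+1 * y`_m.+1).
Proof.
move=> sx sy px py pxy.
have nx : nonconstant x by rewrite /nonconstant sx.
have s1 : (size (1 : {poly R})%R <= m.+2)%N by rewrite size_poly1.
have syx : (size (y - x)%R <= m.+2)%N by apply: size_polyB_leq; rewrite ?sx ?sy.
have sx1 : (size (x + 1)%R <= m.+2)%N by apply: size_polyD_leq; rewrite ?sx.
have sy1 : (size (y + 1)%R <= m.+2)%N by apply: size_polyD_leq; rewrite ?sy.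
have c1 : (1 : {poly R})`_m.+1 = 0 by rewrite coef1.
have [h|h] := equal_degree_pair nx (etrans sx (esym sy)) px py pxy.
- left; have := congr1 (fun p : {poly R} => p`_(m.+1 + m.+1)) h.
  have s1' : (size (y - x - 1)%R <= m.+2)%N by apply: size_polyB_leq.
  rewrite expr2 coefM_top // !coefB c1 subr0.
  rewrite [RHS]nth_default; last first.
    by rewrite size_natM; apply: leq_trans sx1 _; rewrite addSn addnS !ltnS leq_addl.
  by move/eqP; rewrite mulf_eq0 orbb subr_eq0 => /eqP.
- right; have := congr1 (fun p : {poly R} => p`_(m.+1 + m.+1)) h.
  rewrite expr2 coefM_top // -polyC_natr coefCM coefM_top // !coefD !coefN c1.
  by rewrite !addr0 -expr2.
Qed.

(** Each pairwise ratio is 1 or [3 ± 2 √2]. They cannot all differ from 1, since a quotient of two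
    such irrational values is 1 or [(3 ± 2 √2)^2]. The last equation is symmetric in [x], [y], [z];
    once two of them agree, it makes the third 4 times as large, which is not an allowed ratio. *)
Lemma pairwise_ratios_false (R : realFieldType) (x y z : R) :
  0 < x -> 0 < y -> 0 < z ->
  y = x \/ (y - x) ^+ 2 = 4 * (x * y) ->
  z = x \/ (z - x) ^+ 2 = 4 * (x * z) ->
  z = y \/ (z - y) ^+ 2 = 4 * (y * z) ->
  (z - x - y) ^+ 2 = 4 * (x * y) -> False.
Proof.
move=> x0 y0 z0 hxy hxz hyz h.
have xy : 0 < x * y by apply: mulr_gt0.
have xz : 0 < x * z by apply: mulr_gt0.
have yz : 0 < y * z by apply: mulr_gt0.
by case: hxy => hxy; case: hxz => hxz; case: hyz => hyz; subst; nra.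
Qed.

Lemma square_triple_sizes_lt (R : realType) (a b c : {poly R}) :
  nonconstant a -> (size a <= size b)%N -> (size b <= size c)%N ->
  perfect_square (a + 1) -> perfect_square (b + 1) -> perfect_square (c + 1) ->
  perfect_square (a * b + 1) -> perfect_square (a * c + 1) ->
  perfect_square (b * c + 1) -> (size b < size c)%N.
Proof.
move=> na ab bc pa pb pc pab pac pbc; rewrite ltnNge; apply/negP => cb.
have sbc : size b = size c by apply/eqP; rewrite eqn_leq bc cb.
have nb : nonconstant b by apply: leq_trans ab.
have nc : nonconstant c by apply: leq_trans bc.
have a0 := perfect_square_lead_gt0 na pa.
have b0 := perfect_square_lead_gt0 nb pb.
have c0 := perfect_square_lead_gt0 nc pc.
have [ab1 _] := lead_coefD_gt0 (lead_coefM_gt0 a0 b0) (lead_coef_nat_gt0 R 0).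
have [r er r0] := perfect_square_lead_coef pab (lead_coef_gt0_neq0 ab1).
have [d [w [ew eq sd]]] :=
  regular_extension a0 b0 c0 r0 (leq_trans ab bc) bc er pac pbc.
have sab : size (a * b + 1) = (size a + size b).-1.
  rewrite size_polyD1 size_mul ?lead_coef_gt0_neq0 //.
  by move: na nb; rewrite /nonconstant; size_lia.
have d0 : d = 0.
  apply/eqP/negPn/negP => dn; have := sd dn.
  by move: dn na; rewrite /nonconstant -size_poly_gt0 sbc; size_lia.
have sq : (c - a - b) ^+ 2 = 4 * (a * b + 1).
  have -> : c - a - b = 2 * r * w by rewrite -eq d0; ring.
  rewrite d0 mulr0 add0r in ew.
  by rewrite !exprMn -ew -er; ring.
have := congr1 (fun p : {poly R} => size p) sq.
rewrite size_sqr size_natM sab => s1.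
(* By [sq], [c - a - b] has degree [(deg a + deg b) / 2]. If [deg a < deg b], this lies strictly
   between them and exceeds [deg b / 2]. The pair [b], [c] gives [c - b - 1] degree [deg b / 2], or
   [c - b] degree [deg b]; both are incompatible with [sq]. *)
have [sl|se] := ltnP (size a) (size b).
  have [h|h] := equal_degree_pair nb sbc pb pc pbc.
    have := congr1 (fun p : {poly R} => size p) h.
    rewrite size_sqr size_natM size_polyD1 // => s2.
    have : (size (c - a - b)%R <= maxn (size (c - b - 1)%R) (size a))%N.
      have -> : c - a - b = (c - b - 1) - (a - 1) by ring.
      apply: size_polyB_leq; rewrite ?leq_maxl // leq_max; apply/orP; right.
      by apply: size_polyB_leq; rewrite // size_poly1 ltnW.
    by move: na; rewrite /nonconstant; size_lia.
  have := congr1 (fun p : {poly R} => size p) h.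
  rewrite size_sqr size_natM size_mul ?size_polyD1 //; last first.
  - by rewrite -size_poly_gt0 size_polyD1 // ltnW.
  - by rewrite -size_poly_gt0 size_polyD1 // ltnW.
  have : (size (c - b)%R <= (size b).-1)%N.
    have -> : c - b = (c - a - b) + a by ring.
    by apply: size_polyD_leq; size_lia.
  by move: nb; rewrite /nonconstant -sbc; size_lia.
(* All three degrees agree, so only leading coefficients can decide. *)
have sa : size a = size b by apply/eqP; rewrite eqn_leq ab se.
have [m sm] : exists m, size b = m.+2.
  by exists (size b).-2; move: nb; rewrite /nonconstant; case: (size b) => [|[]].
have sam : size a = m.+2 by rewrite sa.
have scm : size c = m.+2 by rewrite -sbc.
have hab := equal_degree_pair_coef sam sm pa pb pab.
have hac := equal_degree_pair_coef sam scm pa pc pac.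
have hbc := equal_degree_pair_coef sm scm pb pc pbc.
have := congr1 (fun p : {poly R} => p`_(m.+1 + m.+1)) sq.
have c1 : (1 : {poly R})`_(m.+1 + m.+1) = 0 by rewrite coef1.
have s3 : (size (c - a - b)%R <= m.+2)%N.
  by apply: size_polyB_leq; [apply: size_polyB_leq|]; rewrite ?sam ?sm ?scm.
rewrite expr2 -polyC_natr coefCM coefD c1 addr0 !coefM_top ?sam ?sm //.
rewrite !coefB.
move: a0 b0 c0 hab hac hbc; rewrite /lead_coef sam sm scm /=.
rewrite -expr2; exact: pairwise_ratios_false.
Qed.

(** * Ordered triples of nonconstant polynomials *)

Lemma square_triple_false (R : realType) (a b c : {poly R}) :
  nonconstant a -> (size a <= size b)%N -> (size b <= size c)%N ->
  perfect_square (a + 1) -> perfect_square (b + 1) -> perfect_square (c + 1) ->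
  perfect_square (a * b + 1) -> perfect_square (a * c + 1) ->
  perfect_square (b * c + 1) -> perfect_square (a * b * c + 1) -> False.
Proof.
move=> na ab bc pa pb pc pab pac pbc pabc.
have bltc := square_triple_sizes_lt na ab bc pa pb pc pab pac pbc.
have nb : nonconstant b by apply: leq_trans ab.
have nc : nonconstant c by apply: leq_trans bc.
have a0 := perfect_square_lead_gt0 na pa.
have b0 := perfect_square_lead_gt0 nb pb.
have c0 := perfect_square_lead_gt0 nc pc.
have one0 := lead_coef_nat_gt0 R 0.
have ab0 := lead_coefM_gt0 a0 b0.
have [ab1 _] := lead_coefD_gt0 ab0 one0.
have [r er r0] := perfect_square_lead_coef pab (lead_coef_gt0_neq0 ab1).
have [d [w [ew eq sd]]] :=
  regular_extension a0 b0 c0 r0 (leq_trans ab bc) bc er pac pbc.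
have [A sA] : exists A, size a = A.+2.
  by exists (size a).-2; move: na; rewrite /nonconstant; case: (size a) => [|[]].
have [B sB] : exists B, size b = B.+2.
  by exists (size b).-2; move: nb; rewrite /nonconstant; case: (size b) => [|[]].
have [C sC] : exists C, size c = C.+2.
  by exists (size c).-2; move: nc; rewrite /nonconstant; case: (size c) => [|[]].
rewrite sA sB sC in ab bc bltc sd.
have sab : size (a * b) = (A + B).+3.
  by rewrite size_mul ?lead_coef_gt0_neq0 // sA sB !addSn !addnS.
have sab1 : size (a * b + 1) = (A + B).+3 by rewrite size_polyD1 sab.
(* Otherwise [(c - a - b)^2 = 4 (a b + 1)], but [2 deg c > deg a + deg b]. *)
have dn : d != 0.
  apply/eqP => d0.
  have sq : (c - (a + b)) ^+ 2 = 4 * (a * b + 1).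
    have -> : c - (a + b) = 2 * r * w by rewrite -eq d0; ring.
    rewrite d0 mulr0 add0r in ew.
    by rewrite !exprMn -ew -er; ring.
  have sc : size (c - (a + b)) = C.+2.
    rewrite size_polyDl ?sC // size_polyN ltnS.
    by apply: size_polyD_leq; rewrite ?sA ?sB; size_lia.
  have := congr1 (fun p : {poly R} => size p) sq.
  by rewrite size_sqr size_natM sab1 sc; size_lia.
have {}sd := sd dn.
have sd1 : (0 < size d)%N by rewrite size_poly_gt0.
have e1 : 1 * (a * b) + 1 = r ^+ 2 by rewrite mul1r.
have p1c : perfect_square (1 * c + 1) by rewrite mul1r.
have s1c : (size (1 : {poly R})%R <= size c)%N by rewrite size_poly1 sC.
have sabc : (size (a * b)%R <= size c)%N by rewrite sab sC; size_lia.
have [d' [w' [ew' eq' sd']]] :=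
  regular_extension one0 ab0 c0 r0 s1c sabc e1 p1c pabc.
rewrite size_poly1 sab sC in sd' sabc.
(* With the shifts in [sA], [sB], [sC], this is [deg c = deg a + deg b]. *)
have [e|ne] := eqVneq C (A + B).+1.
  have cd : (size d <= 1)%N by size_lia.
  have d1 : d = 1.
    move: dn; rewrite (size1_polyC cd).
    have [->|->] : d`_0 = 0 \/ d`_0 = 1; last by rewrite polyC1.
      apply: (perfect_square_scale nc pc); exists w.
      by rewrite -(size1_polyC cd) mulrC.
    by rewrite eqxx.
  have sq : (c + (1 - (a + b))) ^+ 2 = 4 * ((a * b + 1) * (c + 1)).
    have -> : c + (1 - (a + b)) = 2 * r * w by rewrite -eq d1; ring.
    rewrite d1 mulr1 in ew.
    by rewrite !exprMn -ew -er; ring.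
  have s0 : (size (1 - (a + b))%R < C.+2)%N.
    rewrite ltnS; apply: size_polyB_leq; first by rewrite size_poly1.
    by apply: size_polyD_leq; rewrite ?sA ?sB; size_lia.
  rewrite -e in sab sab1.
  have sc1 : size (c + 1) = C.+2 by rewrite size_polyD1 // sC.
  have := congr1 (fun p : {poly R} => p`_(C.+1 + C.+1)) sq.
  have scd : size (c + (1 - (a + b))) = C.+2 by rewrite size_polyDl sC.
  rewrite expr2 -polyC_natr coefCM !coefM_top ?sab1 ?sc1 ?scd //.
  have z0 : (1 - (a + b))`_C.+1 = 0 by rewrite nth_default.
  have c1 : (1 : {poly R})`_C.+1 = 0 by rewrite coef1.
  rewrite !(coefD c) (coefD (a * b)) z0 c1 !addr0.
  have := equal_degree_pair_coef sab sC pab pc pabc.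
  move: ab0 c0; rewrite /lead_coef sab sC /=.
  move: (a * b)`_C.+1 c`_C.+1 => x z; clear => x0 zp hxz hq.
  (* The ratio 4 is neither 1 nor a solution of [(z - x)^2 = 4 x z], as [9] differs from [16]. *)
  have zx : z = 4 * x by apply: (mulIf (lt0r_neq0 zp)); lra.
  by case: hxz; subst z; nra.
have {}ne : (A + B < C.-1)%N by move/eqP: ne => ne; size_lia.
have {}sd' : (size d' + (A + B) <= C)%N.
  by have [->|/sd'] := eqVneq d' 0; [rewrite size_poly0; size_lia | size_lia].
have {}sd : (size d + (A + B) <= C)%N by size_lia.
(* Subtracting and adding the two regularity equations gives [d - d' + K] and [2 c + D - B']. Their
   product involves [r], [w], [w'] only through known squares. *)
pose D := d + d'; pose B' := (a + 1) * (b + 1); pose K := (a - 1) * (b - 1).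
pose M := 4 * (a * b * c) + (2 * c - D + B').
have key : (d - d') * M = K * (2 * c + D - B').
  have h1 : (d - d') + K = 2 * r * (w - w').
    by rewrite mulrBr -eq -eq' /K; ring.
  have h2 : 2 * c + D - B' = 2 * r * (w + w').
    by rewrite mulrDr -eq -eq' /D /B'; ring.
  have h : ((d - d') + K) * (2 * c + D - B') = 4 * (a * b + 1) * c * (d - d').
    rewrite h1 h2.
    have -> : 2 * r * (w - w') * (2 * r * (w + w')) =
      4 * r ^+ 2 * (w ^+ 2 - w' ^+ 2) by ring.
    by rewrite -er -ew -ew'; ring.
  have -> : (d - d') * M =
      4 * (a * b + 1) * c * (d - d') - (d - d') * (2 * c + D - B').
    by rewrite /M; ring.
  by rewrite -h; ring.
have sK : (size K <= (A + B).+3)%N.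
  apply: (@size_polyM_leq _ _ _ A.+1 B.+1); last by size_lia.
    by rewrite size_polyB_leq ?sA ?size_poly1.
  by rewrite size_polyB_leq ?sB ?size_poly1.
have sB' : (size B' <= (A + B).+3)%N.
  apply: (@size_polyM_leq _ _ _ A.+1 B.+1); last by size_lia.
    by rewrite size_polyD_leq ?sA ?size_poly1.
  by rewrite size_polyD_leq ?sB ?size_poly1.
have sD : (size D <= C)%N.
  by apply: size_polyD_leq; [move: sd | move: sd']; apply: leq_trans; rewrite leq_addr.
have sDB : (size (D - B')%R <= C.+1)%N.
  by apply: size_polyB_leq; [exact: leq_trans sD _ | apply: leq_trans sB' _; size_lia].
have sM : size M = (A + B + C).+4.
  have s4 : size (4 * (a * b * c)) = (A + B + C).+4.
    rewrite size_natM size_mul ?lead_coef_gt0_neq0 // sab sC.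
    by rewrite !addSn !addnS.
  rewrite /M size_polyDl s4 // ltnS.
  apply: size_polyD_leq; last by apply: leq_trans sB' _; size_lia.
  apply: size_polyB_leq; last by apply: leq_trans sD _; size_lia.
  by rewrite size_natM sC; size_lia.
(* In [key], the dominant terms are [4 a b c] in [M] and [2 a b c] on the right. Doubling and
   subtracting [M] cancels them, leaving a multiple of [M] of smaller degree than [M]. *)
have half : 2 * (d - d') = 1.
  apply/eqP; rewrite -subr_eq0; apply/negPn/negP => n0.
  have : (size ((2 * (d - d') - 1) * M)%R <= (A + B + C).+3)%N.
    have -> : (2 * (d - d') - 1) * M =
        (2 * K * (D - B') + (D - B')) - (4 * a + 4 * b - 2) * c.
      have -> : (2 * (d - d') - 1) * M = 2 * ((d - d') * M) - M by ring.
      by rewrite key /M /K; ring.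
    apply: size_polyB_leq.
      apply: size_polyD_leq; last by apply: leq_trans sDB _; size_lia.
      rewrite -mulrA size_natM.
      by apply: (@size_polyM_leq _ _ _ (A + B).+2 C) => //; size_lia.
    apply: (@size_polyM_leq _ _ _ B.+1 C.+1); rewrite ?sC //; last by size_lia.
    apply: size_polyB_leq; last exact: size_nat_leq.
    by apply: size_polyD_leq; rewrite size_natM ?sA ?sB.
  have Mn : M != 0 by rewrite -size_poly_gt0 sM.
  rewrite size_mul // sM.
  by move: n0; rewrite -size_poly_gt0; case: (size _) => // n _; size_lia.
have D2 : 2 * D - (4 * d - 1) = 0.
  have -> : 2 * D - (4 * d - 1) = 1 - 2 * (d - d') by rewrite /D; ring.
  by rewrite half subrr.
have M2 : 2 * M - 4 * K * (2 * c + D - B') = 0.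
  have -> : 2 * M - 4 * K * (2 * c + D - B') = (1 - 2 * (d - d')) * (2 * M).
    by rewrite -mulrA -key; ring.
  by rewrite half subrr mul0r.
(* This is [key] after substituting [d' = d - 1/2], arranged so that every term on the left has
   positive leading coefficient. The left degree is thus at least [deg b + deg c], while every term
   on the right has smaller degree; in particular [d K] has degree at most [deg c]. *)
have fin : 8 * (b * c) + (8 * (a * c) + (4 * (a * b * (a * b)) + (4 * (a * b) + 9)))
    = 4 * (c + d + 2 * (d * K) + a * a + b * b).
  apply/eqP; rewrite -subr_eq0; apply/eqP.
  transitivity ((2 * M - 4 * K * (2 * c + D - B')) +
                (1 + 2 * K) * (2 * D - (4 * d - 1))).
    by rewrite /M /K /B'; ring.
  by rewrite D2 M2 mulr0 addr0.
have ac0 := lead_coefM_gt0 a0 c0; have bc0 := lead_coefM_gt0 b0 c0.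
have nat0 n p : 0 < lead_coef p -> 0 < lead_coef (n.+1%:R * p : {poly R}).
  exact: lead_coefM_gt0 (lead_coef_nat_gt0 R n).
have [t1 _] := lead_coefD_gt0 (nat0 3%N _ ab0) (lead_coef_nat_gt0 R 8).
have [t2 _] := lead_coefD_gt0 (nat0 3%N _ (lead_coefM_gt0 ab0 ab0)) t1.
have [t3 _] := lead_coefD_gt0 (nat0 7%N _ ac0) t2.
have [_ st] := lead_coefD_gt0 (nat0 7%N _ bc0) t3.
have : (size (8 * (b * c))%R <= B + C + 2)%N.
  apply: leq_trans (leq_trans (leq_maxl _ _) (eq_leq (esym st))) _.
  apply: leq_trans (eq_leq (congr1 (fun p : {poly R} => size p) fin)) _.
  rewrite size_natM.
  apply: size_polyD_leq; last first.
    by apply: (@size_polyM_leq _ _ _ B.+1 B.+1); rewrite ?sB //; size_lia.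
  apply: size_polyD_leq; last first.
    by apply: (@size_polyM_leq _ _ _ A.+1 A.+1); rewrite ?sA //; size_lia.
  apply: size_polyD_leq; last first.
    rewrite size_natM.
    apply: (@size_polyM_leq _ _ _ (size d).-1 (A + B).+2) => //.
      exact: leqSpred.
    by size_lia.
  apply: size_polyD_leq; first by rewrite sC; size_lia.
  by apply: leq_trans (leq_addr (A + B) _) _; apply: leq_trans sd _; size_lia.
by rewrite size_natM size_mul ?lead_coef_gt0_neq0 // sB sC; size_lia.
Qed.

(** * Reduction to ordered nonconstant triples *)

Lemma nonconstant_transfer (R : realType) (x y : {poly R}) :
  x <> 0 -> x <> 1 -> nonconstant y ->
  perfect_square (y + 1) -> perfect_square (x * y + 1) -> nonconstant x.
Proof.
move=> x0 x1 ny py pxy; rewrite /nonconstant ltnNge; apply/negP => sx.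
move: x0 x1 pxy; rewrite (size1_polyC sx) => x0 x1 pxy.
have [e|e] := perfect_square_scale ny py pxy.
- by apply: x0; rewrite e.
- by apply: x1; rewrite e.
Qed.

Theorem theorem2 (R : realType) :
  ~ (exists a b c : {poly R},
       (a <> b /\ a <> c /\ b <> c) /\
       (a <> 0 /\ b <> 0 /\ c <> 0) /\
       (nonconstant a \/ nonconstant b \/ nonconstant c) /\
       (a <> 1 /\ b <> 1 /\ c <> 1) /\
       (perfect_square (a + 1) /\
        perfect_square (b + 1) /\
        perfect_square (c + 1) /\
        perfect_square (a * b + 1) /\
        perfect_square (a * c + 1) /\
        perfect_square (b * c + 1) /\
        perfect_square (a * b * c + 1))).
Proof.
case=> a [b [c [_ [[a0 [b0 c0]] [nabc [[a1 [b1 c1]]]]]]]].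
case=> pa [pb [pc [pab [pac [pbc pabc]]]]].
have pba : perfect_square (b * a + 1) by rewrite mulrC.
have pca : perfect_square (c * a + 1) by rewrite mulrC.
have pcb : perfect_square (c * b + 1) by rewrite mulrC.
have [na nb nc] : [/\ nonconstant a, nonconstant b & nonconstant c].
  have na : nonconstant a.
    by case: nabc => [//|[nb|nc]];
      [apply: nonconstant_transfer nb _ _ | apply: nonconstant_transfer nc _ _].
  by split=> //; apply: nonconstant_transfer na _ _.
(* The conditions are symmetric, so each ordering of the sizes reduces to the ordered case by
   commuting products. *)
have [ab|/ltnW ab] := leqP (size a) (size b).
- have [bc|/ltnW bc] := leqP (size b) (size c).
    exact: (square_triple_false na ab bc).
  have pacb : perfect_square (a * c * b + 1) by rewrite mulrAC.
  have [ac|/ltnW ac] := leqP (size a) (size c).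
    exact: (square_triple_false na ac bc).
  by apply: (square_triple_false nc ac ab); rewrite // (mulrC c).
- have pbac : perfect_square (b * a * c + 1) by rewrite (mulrC b).
  have [ac|/ltnW ac] := leqP (size a) (size c).
    exact: (square_triple_false nb ab ac).
  have pbca : perfect_square (b * c * a + 1) by rewrite mulrAC.
  have [bc|/ltnW bc] := leqP (size b) (size c).
    exact: (square_triple_false nb bc ac).
  by apply: (square_triple_false nc bc ab); rewrite // (mulrC c).
Qed.
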